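(* Let $n$ be an even integer, $n>4$, and let $G_{t+1}(x)=x^{2^{t+1}-1}$ over $\mathbb{F}_{2^n}$ for $t=\frac n2$. Then $G_{t+1}$ is locally-APN. It is differentially $2^t$-uniform and its differential spectrum is $$\omega_{2^t}=1,\qquad \omega_i=0\ \text{ for all } i \text{ with } 2<i<2^t,\qquad \omega_2=2^{n-1}-2^{t-1},\qquad \omega_0=2^{n-1}+2^{t-1}-1 .$$ Moreover, $G_{t+1}$ is a permutation of $\mathbb{F}_{2^n}$ if and only if $n\equiv 0\bmod 4$.
   Context: For $b\in\mathbb{F}_{2^n}$, $\delta(b)=\#\{x\in\mathbb{F}_{2^n} : G_{t+1}(x+1)+G_{t+1}(x)=b\}$. The function is differentially $k$-uniform if $\max_{b\in\mathbb{F}_{2^n}}\delta(b)=k$. The differential spectrum is the family $\omega_i=\#\{b\in\mathbb{F}_{2^n} : \delta(b)=i\}$. The function is called locally-APN if $\delta(b)\le 2$ for all $b\in\mathbb{F}_{2^n}\setminus\mathbb{F}_2$. *)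

(* Defs.v *)
From HB Require Import structures.
From mathcomp Require Import all_boot all_order all_algebra.

Set Implicit Arguments.
Unset Strict Implicit.
Unset Printing Implicit Defensive.

Import GRing.Theory.
Local Open Scope ring_scope.

(* A finite field F_{2^n} is any F : finFieldType with #|F| = 2 ^ n. *)

Definition G (F : finFieldType) (k : nat) (x : F) : F := x ^+ (2 ^ k - 1)%N.

(* Only the difference direction 1 is used. For power maps this is enough:
   replacing (x, b) by (a x, a^d b) reduces any direction a <> 0 to 1. *)
Definition delta (F : finFieldType) (f : F -> F) (b : F) : nat :=
  #|[set x : F | f (x + 1) + f x == b]|.

Definition differentially_uniform (F : finFieldType) (f : F -> F) (k : nat)
  : Prop := (\max_(b : F) delta f b)%N = k.

Definition omega (F : finFieldType) (f : F -> F) (i : nat) : nat :=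
  #|[set b : F | delta f b == i]|.

(* [set 0; 1] is the prime subfield F_2 when F has characteristic 2. *)
Definition locally_APN (F : finFieldType) (f : F -> F) : Prop :=
  forall b : F, b \notin [set 0; 1] -> (delta f b <= 2)%N.

(* Main.v *)
(** Write q = 2^t, so that F = F_{q^2}, let y = x^q be the conjugate of x and
    T = x + y its trace to F_q.  Since x G(x) = y^2, setting
    c = G(x+1) + G(x) + 1 gives c (x^2 + x) = T^2 for every x.  Hence the fibre
    of the derivative over 1 is the subfield F_q.  If c <> 0, dividing by c and
    adding the conjugate equation gives T^2 + T = Tr(1/c) T^2 with T <> 0, which
    determines T, then x^2 + x, then x up to x |-> x + 1.  So every other fibre
    has 0 or 2 elements and the spectrum follows by counting.  Finally G is
    injective iff gcd(2q - 1, q^2 - 1) = 1, and this gcd is 1 for even t and 3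
    for odd t. *)
Require Import Defs.
From HB Require Import structures.
From mathcomp Require Import all_boot all_order all_algebra.
From mathcomp Require Import all_fingroup all_solvable all_field ring zify.

Import GRing.Theory.

Lemma expn2_even_mod3 k : ~~ odd k -> 2 ^ k = 1 %[mod 3].
Proof.
move=> k_even; rewrite -(odd_double_half k) (negbTE k_even) add0n -muln2 mulnC.
by rewrite expnM -modnXm exp1n.
Qed.

Section QuadraticExtension.
Local Open Scope ring_scope.

Variables (F : finFieldType) (t : nat).
Hypotheses (t_gt0 : (0 < t)%N) (cardF : #|F| = (2 ^ t.*2)%N).

Local Notation g := (@G F t.+1).
Local Notation conj x := (x ^+ (2 ^ t)%N).

(** * Conjugation in characteristic 2 *)

Lemma pchar2 : 2%N \in [pchar F].
Proof. by rewrite (card_finPcharP cardF). Qed.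

Lemma two0 : 2 = 0 :> F.
Proof. exact: pcharf0 pchar2. Qed.

Lemma addr_eq0_pchar2 (x y : F) : (x + y == 0) = (x == y).
Proof. by rewrite -{1}[y](oppr_pchar2 pchar2) subr_eq0. Qed.

Lemma conjD (x y : F) : conj (x + y) = conj x + conj y.
Proof.
by apply: exprDn_pchar; rewrite pnatX (pnatE _ (isT : prime 2)) pchar2.
Qed.

Lemma conjK (x : F) : conj (conj x) = x.
Proof. by rewrite -exprM -expnD addnn -cardF expf_card. Qed.

(** The exponent of [g] is 2q - 1, so one more factor [x] gives x^(2q). This product form covers x =
    0 as well. *)
Lemma mul_G (x : F) : x * g x = conj x ^+ 2.
Proof.
by rewrite /G -exprS -exprM -expnSr subn1 prednK // expn_gt0.
Qed.

Lemma G0 : g 0 = 0.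
Proof.
by rewrite /G expr0n subn_eq0 leqNgt -{1}(expn0 2) ltn_exp2l.
Qed.

Lemma G1 : g 1 = 1.
Proof. by rewrite /G expr1n. Qed.

(** * Fibres of the derivative *)

Definition derivG (x : F) : F := g (x + 1) + g x.

Lemma derivG0 : derivG 0 = 1.
Proof. by rewrite /derivG add0r G0 G1 addr0. Qed.

Lemma derivGS (x : F) : derivG (x + 1) = derivG x.
Proof. by rewrite /derivG -addrA (addrr_pchar2 pchar2) addr0 addrC. Qed.

Lemma derivG1 : derivG 1 = 1.
Proof. by rewrite -[1 in LHS]add0r derivGS derivG0. Qed.

(** The factor x(x + 1) turns both values of [g] into conjugate squares through [mul_G]; what
    remains differs from T^2 by a multiple of 2. *)
Lemma derivG_trace (x : F) :
  (derivG x + 1) * (x ^+ 2 + x) = (x + conj x) ^+ 2.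
Proof.
have Hx := mul_G x; have := mul_G (x + 1).
rewrite conjD expr1n /derivG => Hx1.
have -> : (g (x + 1) + g x + 1) * (x ^+ 2 + x)
    = x * ((x + 1) * g (x + 1)) + (x + 1) * (x * g x) + (x ^+ 2 + x) by ring.
rewrite Hx Hx1; set y := conj x.
have -> : x * (y + 1) ^+ 2 + (x + 1) * y ^+ 2 + (x ^+ 2 + x)
    = (x + y) ^+ 2 + 2 * (x * y ^+ 2 + x) by ring.
by rewrite two0 mul0r addr0.
Qed.

Lemma sqr_add_self_eq0 (x : F) : x ^+ 2 + x = 0 -> x = 0 \/ x = 1.
Proof.
have -> : x ^+ 2 + x = x * (x + 1) by ring.
move=> /eqP; rewrite mulf_eq0 addr_eq0_pchar2.
by case/orP => /eqP; [left | right].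
Qed.

Lemma derivG_eq1 (x : F) : (derivG x == 1) = (conj x == x).
Proof.
rewrite -(addr_eq0_pchar2 (derivG x)) [RHS]eq_sym -(addr_eq0_pchar2 x).
have Hx := derivG_trace x; apply/idP/idP => /eqP H0.
  by move/eqP: Hx; rewrite H0 mul0r eq_sym sqrf_eq0 => /eqP ->.
move/eqP: Hx; rewrite H0 expr0n /= mulf_eq0 => /orP[//|/eqP].
(* Here [x] is 0 or 1, where the trace identity reads 0 = 0, so the derivative is evaluated
   directly. *)
by case/sqr_add_self_eq0 => ->; rewrite ?derivG1 ?derivG0 (addrr_pchar2 pchar2).
Qed.

Lemma derivG_fiber (x z : F) :
  derivG x = derivG z -> derivG x != 1 -> z = x \/ z = x + 1.
Proof.
move=> Exz nx1; have nz1 : derivG z != 1 by rewrite -Exz.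
set c := derivG x + 1.
have c_neq0 : c != 0 by rewrite addr_eq0_pchar2.
have solved w : derivG w = derivG x -> w ^+ 2 + w = c^-1 * (w + conj w) ^+ 2.
  by move=> Ew; rewrite -derivG_trace Ew mulKf.
have trace_eq w : derivG w = derivG x ->
    (w + conj w) + 1 = (c^-1 + conj (c^-1)) * (w + conj w).
  move=> Ew; have nw0 : w + conj w != 0.
    by rewrite addr_eq0_pchar2 eq_sym -derivG_eq1 Ew.
  have Hw := solved w Ew.
  have Hw' : conj w ^+ 2 + conj w = conj (c^-1) * (w + conj w) ^+ 2.
    rewrite -[conj w ^+ 2]exprAC -conjD Hw exprMn [in LHS]exprAC.
    by rewrite conjD conjK [conj w + w]addrC.
  (* Multiplied by the nonzero trace, the claim is the sum of [Hw] and its conjugate [Hw'], up to a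
     multiple of 2. *)
  apply: (mulfI nw0).
  have -> : (w + conj w) * (w + conj w + 1)
      = (w ^+ 2 + w) + (conj w ^+ 2 + conj w) + 2 * (w * conj w) by ring.
  by rewrite two0 mul0r addr0 Hw Hw'; ring.
have Hx := trace_eq x erefl; have Hz := trace_eq z (esym Exz).
have Exz_tr : x + conj x = z + conj z.
  move: Hx Hz; set d := c^-1 + _; move: (x + _) (z + _) => T U Hx Hz.
  (* Cross-multiplying T + 1 = dT and U + 1 = dU eliminates d; cancelling TU leaves U = T. *)
  have : (T + 1) * U = (U + 1) * T by rewrite Hx Hz; ring.
  by rewrite !mulrDl !mul1r (mulrC U T) => /addrI.
have : x ^+ 2 + x = z ^+ 2 + z.
  by rewrite (solved x) // (solved z (esym Exz)) Exz_tr.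
move/eqP; rewrite -addr_eq0_pchar2 => /eqP Hs.
(* By [Hs], s = x + z satisfies s^2 + s = 0 in characteristic 2, so s is 0 or 1. *)
have /eqP : (x + z) ^+ 2 + (x + z) = 2 * (x * z).
  by rewrite -[RHS]add0r -Hs; ring.
rewrite two0 mul0r => /eqP /sqr_add_self_eq0 [/eqP|].
  by rewrite addr_eq0_pchar2 => /eqP; left.
move=> E; right; rewrite -E addrA (addrr_pchar2 pchar2).
by rewrite add0r.
Qed.

(** * Size of the fixed field of conjugation *)

(** The fibre consists of roots of X^q + X - z, which has degree q because q > 1. *)
Lemma card_trace_fiber (z : F) :
  (#|[set x : F | (x + conj x == z)%R]| <= 2 ^ t)%N.
Proof.
pose p : {poly F} := 'X^(2 ^ t) + ('X - z%:P).
have size_p : size p = (2 ^ t).+1.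
  rewrite size_polyDl size_polyXn // size_XsubC ltnS.
  exact: leq_ltn_trans t_gt0 (ltn_expl t (isT : 1 < 2)%N).
have p_neq0 : p != 0 by rewrite -size_poly_eq0 size_p.
rewrite cardE -ltnS -size_p; apply: max_poly_roots => //; last exact: enum_uniq.
apply/allP => x; rewrite mem_enum inE => /eqP Ez.
rewrite /root hornerD hornerXn hornerXsubC -Ez addrA [conj x + x]addrC.
by rewrite subrr.
Qed.

(* The trace maps F to the fixed field K with fibres of at most q elements, so
   q^2 <= |K| q. *)
Lemma card_conj_fixed : #|[set x : F | conj x == x]| = (2 ^ t)%N.
Proof.
set K := [set x | _]; apply/eqP; rewrite eqn_leq; apply/andP; split.
  (* Upper bound: fixed points have trace 0. *)
  rewrite (leq_trans _ (card_trace_fiber 0)) //; apply/subset_leq_card.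
  by apply/subsetP => x; rewrite !inE addr_eq0_pchar2 eq_sym.
have q_gt0 : (0 < 2 ^ t)%N by rewrite expn_gt0.
rewrite -(leq_pmul2r q_gt0) -expnD addnn -cardF -sum_nat_const -sum1_card.
rewrite (partition_big (fun x : F => x + conj x) (mem K)) /=; last first.
  by move=> x _; rewrite inE conjD conjK addrC.
apply: leq_sum => z _; rewrite sum1_card.
by rewrite (leq_trans _ (card_trace_fiber z)) // -cardsE.
Qed.

(** * Differential spectrum *)

Lemma delta_G1 : delta g 1 = (2 ^ t)%N.
Proof.
rewrite -card_conj_fixed /delta; apply: eq_card => x.
by rewrite !inE -derivG_eq1.
Qed.

Lemma delta_G_dichotomy (b : F) :
  b != 1 -> delta g b = 0%N \/ delta g b = 2%N.
Proof.
move=> nb1; rewrite /delta; set A := [set x | _].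
have [->|[x xA]] := set_0Vmem A; first by left; rewrite cards0.
right; have Ex : derivG x = b by move: xA; rewrite inE => /eqP.
suff -> : A = [set x; x + 1].
  by rewrite cards2 -{1}[x]addr0 (inj_eq (addrI x)) eq_sym oner_eq0.
apply/setP => z; rewrite !inE; apply/idP/orP => [/eqP Ez|].
  case: (@derivG_fiber x z); rewrite ?Ex // => ->; rewrite eqxx.
    by left.
  by right.
by case=> /eqP ->; apply/eqP; rewrite -/(derivG _) ?derivGS.
Qed.

Hypothesis t_gt1 : (1 < t)%N.

(** Keeps the value 1 out of the set counted by [omega g 2]; for t = 1 it would belong there. *)
Lemma delta_G1_neq2 : delta g 1 != 2%N.
Proof. by rewrite delta_G1 -{2}(expn1 2) eqn_exp2l // neq_ltn t_gt1 orbT. Qed.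

(** Counts the elements of [F] by their derivative: 2^t lie over 1, and every other nonempty fibre
    has two. *)
Lemma omega_G2 : (2 ^ t.*2 = 2 ^ t + 2 * omega g 2)%N.
Proof.
rewrite -cardF -sum1_card (partition_big derivG predT) //= (bigD1 1) //=.
have sumE b : (\sum_(x | derivG x == b) 1 = delta g b)%N.
  by rewrite sum1_card /delta cardsE.
rewrite sumE delta_G1; congr addn; rewrite mulnC -sum_nat_const.
rewrite big_mkcond [RHS]big_mkcond; apply: eq_bigr => b _.
rewrite sumE inE.
have [->|nb1] := eqVneq b 1 => /=; first by rewrite (negbTE delta_G1_neq2).
by case: (delta_G_dichotomy b nb1) => ->.
Qed.

(** Counts values instead of arguments: 1, those with two preimages, and the rest, which have
    none. *)
Lemma omega_G0 : (2 ^ t.*2 = 1 + omega g 2 + omega g 0)%N.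
Proof.
have -> : (1 + omega g 2 = #|1%R |: [set b | delta g b == 2%N]|)%N.
  by rewrite cardsU1 inE delta_G1_neq2.
rewrite -cardF -(cardsC (1 |: [set b | delta g b == 2%N])).
congr addn; apply: eq_card => b.
rewrite !inE negb_or; have [->|nb1] /= := eqVneq b 1.
  by rewrite delta_G1 expn_eq0.
by case: (delta_G_dichotomy b nb1) => ->.
Qed.

(** * Injectivity and cube roots of unity *)

(** The ratio w of two nonzero points with equal image has g(w) = 1, so w is the square of its
    conjugate and, conjugating, conj(w) = w^2. Hence w^3 = 1; for even [t], q is 1 mod 3, so conj(w)
    = w and w = 1. *)
Lemma G_injective_even : ~~ odd t -> injective g.
Proof.
move=> t_even x z Exz.
have gE u : g u = 0 -> u = 0.
  move=> /eqP gu0; move: (mul_G u); rewrite (eqP gu0) mulr0 => /esym/eqP.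
  by rewrite !expf_eq0 => /and3P[_ _ /eqP].
have [z0|nz0] := eqVneq z 0.
  by apply: etrans (esym z0); apply: gE; rewrite Exz z0 G0.
have ngz0 : g z != 0 by apply: contra_neq nz0 => /gE.
set w := x / z.
have gw1 : g w = 1 by rewrite /w {1}/G expr_div_n -/(g x) -/(g z) Exz divff.
have w_neq0 : w != 0.
  by apply/eqP => w0; move/eqP: gw1; rewrite w0 G0 eq_sym oner_eq0.
have Ew : w = conj w ^+ 2 by rewrite -mul_G gw1 mulr1.
have Ecw : conj w = w ^+ 2 by rewrite {1}Ew exprAC conjK.
have w3 : w ^+ 3 = 1.
  by apply: (mulfI w_neq0); rewrite mulr1 -exprS (exprM w 2 2) -Ecw -Ew.
have cw : conj w = w by rewrite -(expr_mod _ w3) expn2_even_mod3 // expr1.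
have w1 : w = 1 by apply: (mulfI w_neq0); rewrite mulr1 -expr2 -Ecw.
by rewrite -[x](divfK nz0) -/w w1 mul1r.
Qed.

(** The unit group has order 4^t - 1, a multiple of 3, so Cauchy's theorem applies. *)
Lemma exists_cube_root1 : exists2 w : F, w ^+ 3 = 1 & w != 1.
Proof.
have d3 : (3 %| #|[set: {unit F}]|)%N.
  by rewrite card_finField_unit cardF -subn1 -eqn_mod_dvd ?expn_gt0 //
     expn2_even_mod3 // odd_double.
have [u _ u_order] := Cauchy (isT : prime 3) d3.
exists (val u).
  by rewrite -FinRing.val_unitX -u_order expg_order.
apply/eqP => u1; have u_1 : u = 1%g by apply: val_inj.
by move: u_order; rewrite u_1 order1.
Qed.

(** For odd [t] the exponent 2^(t+1) - 1 is a multiple of 3, so a nontrivial cube root of unity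
    collides with 1. *)
Lemma G_not_injective_odd : odd t -> ~ injective g.
Proof.
move=> t_odd g_inj; have [w w3 /eqP] := exists_cube_root1; apply.
have /dvdnP[k Ek] : (3 %| 2 ^ t.+1 - 1)%N.
  by rewrite -eqn_mod_dvd ?expn_gt0 // expn2_even_mod3 //= t_odd.
by apply: g_inj; rewrite G1 /G Ek mulnC exprM w3 expr1n.
Qed.

Lemma G_bijective : bijective g <-> ~~ odd t.
Proof.
split=> [g_bij|t_even]; last exact: injF_bij (G_injective_even t_even).
by apply/negP => t_odd; apply: (G_not_injective_odd t_odd); apply: bij_inj.
Qed.

End QuadraticExtension.

Theorem theorem8 (F : finFieldType) (n t : nat)
    (n_even : ~~ odd n) (n_gt4 : 4 < n) (t_def : t = n./2)
    (cardF : #|F| = 2 ^ n) :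
  [/\ locally_APN (@G F t.+1),
      differentially_uniform (@G F t.+1) (2 ^ t),
      [/\ omega (@G F t.+1) (2 ^ t) = 1,
          forall i : nat, 2 < i < 2 ^ t -> omega (@G F t.+1) i = 0,
          omega (@G F t.+1) 2 = 2 ^ (n - 1) - 2 ^ (t - 1)
        & omega (@G F t.+1) 0 = 2 ^ (n - 1) + 2 ^ (t - 1) - 1]
    & bijective (@G F t.+1) <-> n = 0 %[mod 4]].
Proof.
have Dn : n = t.*2 by rewrite t_def even_halfK.
have t_gt1 : 1 < t by lia.
have t_gt0 : 0 < t := ltnW t_gt1.
have q_gt2 : 2 < 2 ^ t := leq_ltn_trans t_gt1 (ltn_expl t (isT : 1 < 2)).
move: cardF; rewrite Dn => cardF2.
have delta1 := @delta_G1 F t t_gt0 cardF2.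
have dich b := @delta_G_dichotomy F t cardF2 b.
have w2 := @omega_G2 F t t_gt0 cardF2 t_gt1.
have w0 := @omega_G0 F t t_gt0 cardF2 t_gt1.
(* Together with [w2] and [w0], these two halvings make the stated values of [omega] at 2 and 0 a
   matter of linear arithmetic. *)
have Eq2 : 2 ^ t.*2 = 2 * 2 ^ (t.*2 - 1).
  by rewrite -expnS subn1 prednK ?double_gt0.
have Eq1 : 2 ^ t = 2 * 2 ^ (t - 1) by rewrite -expnS subn1 prednK.
split.
- move=> b; rewrite !inE negb_or => /andP[_ /dich[]] -> //.
- apply/eqP; rewrite eqn_leq; apply/andP; split; last first.
    by rewrite -{1}delta1 leq_bigmax.
  apply/bigmax_leqP => b _; have [->|/dich[]-> //] := eqVneq b 1%R.
    by rewrite delta1.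
  exact: ltnW.
- split; try lia.
  + rewrite /omega; apply/eqP/cards1P; exists 1%R; apply/setP => b.
    rewrite !inE.
    have [->|/dich[]->] := eqVneq b 1%R; first by rewrite delta1 eqxx.
      by rewrite eq_sym gtn_eqF // ltnW // ltnW.
    by rewrite eq_sym gtn_eqF.
  + move=> i /andP[i_gt2 i_ltq]; apply/eqP; rewrite cards_eq0.
    apply/eqP/setP => b; rewrite !inE.
    have [->|/dich[]->] := eqVneq b 1%R; first by rewrite delta1 gtn_eqF.
      by rewrite ltn_eqF // ltnW // ltnW.
    by rewrite ltn_eqF.
- apply: (iff_trans (@G_bijective F t cardF2)).
  by split; lia.
Qed.
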